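(* Consider a robotic manipulator with equation of motion $M(q)\ddot q+C(q,\dot q)\dot q+G(q)=T+T_e$, with the notation of the context. Suppose that: (A1) the end-effector lies in a region $D\subset SE(3)$ in which the body Jacobian $J_b(q)$ is full-rank, i.e. non-singular; (A2) the end-effector and the desired trajectory lie in the reachable set $\mathcal R=\{p(\theta)\mid \theta\in\mathcal S\}\subset\mathbb R^3$, and the desired trajectory $g_d(t)$ is continuously differentiable. Let $K_p,K_R\in\mathbb R^{3\times 3}$ and $K_d\in\mathbb R^{6\times 6}$ be symmetric positive definite. Let $T=J_b(q)^T\tilde T$ be given by the control law $$\tilde T=\tilde M\dot V_d^*+\tilde C V_d^*+\tilde G-f_g-K_d e_V .$$ Let $T_e=0$. Then the Lyapunov function $$V(t,q,\dot q)=\tfrac12 e_V^T\tilde M e_V+P(t,q)$$ satisfies, along the closed-loop system, $$\dot V=-e_V^TK_de_V .$$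
   Context: Hat and vee maps. For $\omega\in\mathbb R^3$, $\hat\omega\in\mathfrak{so}(3)$ is the skew-symmetric matrix with $\hat\omega v=\omega\times v$. For $\xi=(v,\omega)\in\mathbb R^3\times\mathbb R^3$, $\hat\xi=\begin{bmatrix}\hat\omega&v\\ 0&0\end{bmatrix}\in\mathfrak{se}(3)$. The inverse of the hat map is denoted $(\cdot)^\vee$. Manipulator. All joints are revolute, and $q\in\mathcal S=(\mathbb S^1)^n$. Since $J_b$ is required to be invertible, $n=6$. The end-effector configuration is $g(q)=e^{\hat\xi_1q_1}\cdots e^{\hat\xi_nq_n}g(0)=\begin{bmatrix}R(q)&p(q)\\ 0&1\end{bmatrix}\in SE(3)$, with fixed joint twists $\xi_i\in\mathbb R^6$. The body velocity $V^b=\begin{bmatrix}v^b\\ \omega^b\end{bmatrix}\in\mathbb R^6$ is defined by $\hat V^b=g^{-1}\dot g$, and the body Jacobian $J_b(q)$ by $V^b=J_b(q)\dot q$. Dynamics. $M(q)$ is the symmetric positive definite inertia matrix, and $G(q)\in\mathbb R^n$ is the gravity term. $T$ is the control torque and $T_e$ the external disturbance torque. The Coriolis matrix has entries $C_{rs}=\frac12\sum_{t=1}^n\left[\frac{\partial M_{rs}}{\partial q_t}+\frac{\partial M_{tr}}{\partial q_s}-\frac{\partial M_{ts}}{\partial q_r}\right]\dot q_t$, so that $\dot M-2C$ is skew-symmetric. Where $J_b$ is invertible, the dynamics are equivalent to $\tilde M\dot V^b+\tilde CV^b+\tilde G=\tilde T+\tilde T_e$, where $\tilde M=J_b^{-T}MJ_b^{-1}$,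 $\tilde C=J_b^{-T}(C-MJ_b^{-1}\dot J_b)J_b^{-1}$, $\tilde G=J_b^{-T}G$, $\tilde T=J_b^{-T}T$, $\tilde T_e=J_b^{-T}T_e$. Desired trajectory and velocity error. The desired trajectory is $g_d(t)=\begin{bmatrix}R_d&p_d\\ 0&1\end{bmatrix}\in SE(3)$, with body velocity $V_d^b=\begin{bmatrix}v_d\\ \omega_d\end{bmatrix}$, $\hat V_d^b=g_d^{-1}\dot g_d$. It is regular enough that $\dot V_d^b$, which appears in the control law, exists. Put $g_{ed}=g^{-1}g_d$, $R_{ed}=R^TR_d$, $p_{ed}=-R^T(p-p_d)$, and $\mathrm{Ad}_{g_{ed}}=\begin{bmatrix}R_{ed}&\hat p_{ed}R_{ed}\\ 0&R_{ed}\end{bmatrix}$. Then $V_d^*=\mathrm{Ad}_{g_{ed}}V_d^b$ and $\dot V_d^*=\left(\frac{d}{dt}\mathrm{Ad}_{g_{ed}}\right)V_d^b+\mathrm{Ad}_{g_{ed}}\dot V_d^b$. The velocity error is $e_V=V^b-V_d^*=\begin{bmatrix}e_v\\ e_\Omega\end{bmatrix}\in\mathbb R^6$. Potential and elastic force. $P(t,q)=\mathrm{tr}\left(K_R(I-R_d^TR)\right)+\frac12(p-p_d)^TR_dK_pR_d^T(p-p_d)$, and $f_g=\begin{bmatrix}f_p\\ f_R\end{bmatrix}=\begin{bmatrix}R^TR_dK_pR_d^T(p-p_d)\\ (K_RR_d^TR-R^TR_dK_R)^\vee\end{bmatrix}\in\mathbb R^6$. *)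

(* Defs.v *)
From HB Require Import structures.
From mathcomp Require Export all_boot all_order all_algebra.
From mathcomp Require Export all_classical all_reals all_analysis.

Set Implicit Arguments.
Unset Strict Implicit.
Unset Printing Implicit Defensive.

Import Order.TTheory GRing.Theory Num.Theory.
Import numFieldNormedType.Exports.

Local Open Scope ring_scope.
Local Open Scope classical_set_scope.

(* Vectors are column vectors.  Twists and body velocities are stacked as
   (v, omega), with the linear part first. *)

Section RigidMotions.
Variable R : realType.

Definition sym_posdef n (A : 'M[R]_n) : Prop :=
  A^T = A /\ forall x : 'cV[R]_n, x != 0 -> 0 < (x^T *m A *m x) 0 0.

Definition mx3 (a b c d e f g h i : R) : 'M[R]_3 :=
  \matrix_(r < 3, s < 3)
    nth 0 (nth [::] [:: [:: a; b; c]; [:: d; e; f]; [:: g; h; i]] r) s.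

Definition vec3 (a b c : R) : 'cV[R]_3 := \col_(r < 3) nth 0 [:: a; b; c] r.

Definition cross (u v : 'cV[R]_3) : 'cV[R]_3 :=
  let x k := u (inord k) 0 in let y k := v (inord k) 0 in
  vec3 (x 1%N * y 2%N - x 2%N * y 1%N)
       (x 2%N * y 0%N - x 0%N * y 2%N)
       (x 0%N * y 1%N - x 1%N * y 0%N).

Definition hat3 (w : 'cV[R]_3) : 'M[R]_3 :=
  let x k := w (inord k) 0 in
  mx3 0 (- x 2%N) (x 1%N)
      (x 2%N) 0 (- x 0%N)
      (- x 1%N) (x 0%N) 0.

(* The inverse of hat3 on skew-symmetric matrices, see hat3K and vee3K; on
   other matrices it reads three entries and has no meaning. *)
Definition vee3 (A : 'M[R]_3) : 'cV[R]_3 :=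
  vec3 (A (inord 2) (inord 1)) (A (inord 0) (inord 2)) (A (inord 1) (inord 0)).

Lemma hat3_cross (w v : 'cV[R]_3) : hat3 w *m v = cross w v.
Proof.
have o0 : inord 0 = 0 :> 'I_3 by apply: val_inj; rewrite /= inordK.
have o1 : inord 1 = 1 :> 'I_3 by apply: val_inj; rewrite /= inordK.
have o2 : inord 2 = lift 0 (lift 0 0) :> 'I_3.
  by apply: val_inj; rewrite /= inordK.
apply/colP => i; rewrite !mxE !big_ord_recl big_ord0 !mxE /= o0 o1 o2.
rewrite (_ : lift 0 0 = 1 :> 'I_3); last exact: val_inj.
by case: i => [[|[|[|//]]] ?] /=;
   rewrite ?mul0r ?addr0 ?add0r ?mulNr // addrC.
Qed.

Lemma hat3K : cancel hat3 vee3.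
Proof.
move=> w; apply/colP => i; rewrite !mxE !inordK //=.
by case: i => [[|[|[|//]]] ?] /=; congr (w _ _); apply: val_inj;
   rewrite /= inordK.
Qed.

Lemma vee3K (A : 'M[R]_3) : A^T = - A -> hat3 (vee3 A) = A.
Proof.
move=> /matrixP skA.
have sk r s : A r s = - A s r by have := skA s r; rewrite !mxE.
have dg r : A r r = 0.
  by apply/eqP; rewrite -[_ == _](mulrn_eq0 _ 2) mulr2n {1}sk addNr.
apply/matrixP => r s; rewrite !mxE !inordK //=.
case: r s => [[|[|[|//]]] hr] [[|[|[|//]]] hs] /=;
  rewrite -?sk; first [rewrite -[LHS](dg (Ordinal hr)) | idtac];
  by congr (A _ _); apply: val_inj; rewrite /= ?inordK.
Qed.

Definition hat6 (xi : 'cV[R]_(3 + 3)) : 'M[R]_(3 + 1) :=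
  block_mx (hat3 (dsubmx xi)) (usubmx xi) 0 0.

Definition vee6 (X : 'M[R]_(3 + 1)) : 'cV[R]_(3 + 3) :=
  col_mx (ursubmx X) (vee3 (ulsubmx X)).

Definition rot (g : 'M[R]_(3 + 1)) : 'M[R]_3 := ulsubmx g.
Definition pos (g : 'M[R]_(3 + 1)) : 'cV[R]_3 := ursubmx g.

Definition SE3 : set 'M[R]_(3 + 1) :=
  [set g | (rot g)^T *m rot g = 1%:M /\ \det (rot g) = 1 /\
           g = block_mx (rot g) (pos g) 0 1%:M].

Definition Ad (g : 'M[R]_(3 + 1)) : 'M[R]_(3 + 3) :=
  block_mx (rot g) (hat3 (pos g) *m rot g) 0 (rot g).

Definition expmx n (A : 'M[R]_n) : 'M[R]_n :=
  limn (series (fun k : nat => (k`!%:R)^-1 *: A ^+ k)).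

(* (g^-1 g')^vee for a curve g in SE(3) *)
Definition body_velocity (g : R -> 'M[R]_(3 + 1)) (t : R) : 'cV[R]_(3 + 3) :=
  vee6 (invmx (g t) *m derive1 g t).

End RigidMotions.

(* Joint angles in (S^1)^6 are represented by real angles in 'cV[R]_6; a
   function on (S^1)^6 is a function that is 2 pi-periodic in each angle. *)
Section Manipulator.
Variable R : realType.

Definition joint_periodic (T : Type) (F : 'cV[R]_6 -> T) : Prop :=
  forall (i : 'I_6) (q : 'cV[R]_6), F (q + (2 * pi) *: delta_mx i 0) = F q.

(* The twist of a rotation about the axis through c with unit direction w. *)
Definition revolute (xi : 'cV[R]_(3 + 3)) : Prop :=
  exists w c : 'cV[R]_3,
    w^T *m w = 1%:M /\ xi = col_mx (- cross w c) w.

Variables (xi : 'I_6 -> 'cV[R]_(3 + 3)) (g0 : 'M[R]_(3 + 1)).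

Definition fkin (q : 'cV[R]_6) : 'M[R]_(3 + 1) :=
  (\prod_(i < 6) expmx (q i 0 *: hat6 (xi i))) *m g0.

Definition reachable : set 'cV[R]_3 :=
  [set pos (fkin th) | th in [set: 'cV[R]_6]].

(* A motion through q with joint velocity qd has g' = 'D_qd fkin q. *)
Definition Vb (q qd : 'cV[R]_6) : 'cV[R]_(3 + 3) :=
  vee6 (invmx (fkin q) *m 'D_qd fkin q).

(* The matrix of the linear map qd |-> Vb q qd. *)
Definition Jb (q : 'cV[R]_6) : 'M[R]_6 :=
  \matrix_(i < 6, j < 6) (Vb q (delta_mx j 0) : 'cV[R]_6) i 0.

Variables (M : 'cV[R]_6 -> 'M[R]_6) (G : 'cV[R]_6 -> 'cV[R]_6).

Definition coriolis (q qd : 'cV[R]_6) : 'M[R]_6 :=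
  let dM (i j k : 'I_6) := 'D_(delta_mx k 0 : 'cV[R]_6) (fun x => M x i j) q in
  \matrix_(r < 6, s < 6)
    (2^-1 * \sum_(t < 6) (dM r s t + dM t r s - dM t s r) * qd t 0).

Definition Mtilde (q : 'cV[R]_6) : 'M[R]_6 :=
  (invmx (Jb q))^T *m M q *m invmx (Jb q).

Definition Gtilde (q : 'cV[R]_6) : 'cV[R]_6 := (invmx (Jb q))^T *m G q.

(* Below, q is a motion R -> 'cV[R]_6, and the dots on Jb, Ad and V_d are
   time derivatives along it. *)
Definition Ctilde (q : R -> 'cV[R]_6) (t : R) : 'M[R]_6 :=
  (invmx (Jb (q t)))^T
  *m (coriolis (q t) (derive1 q t)
      - M (q t) *m invmx (Jb (q t)) *m derive1 (Jb \o q) t)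
  *m invmx (Jb (q t)).

Variables (gd : R -> 'M[R]_(3 + 1)).

Definition ged (t : R) (q : 'cV[R]_6) : 'M[R]_(3 + 1) :=
  invmx (fkin q) *m gd t.

Definition Vdstar (t : R) (q : 'cV[R]_6) : 'cV[R]_6 :=
  Ad (ged t q) *m body_velocity gd t.

Definition dVdstar (q : R -> 'cV[R]_6) (t : R) : 'cV[R]_6 :=
  derive1 (fun s => Ad (ged s (q s))) t *m body_velocity gd t
  + Ad (ged t (q t)) *m derive1 (body_velocity gd) t.

Definition eV (t : R) (q qd : 'cV[R]_6) : 'cV[R]_6 := Vb q qd - Vdstar t q.

Variables (Kp KR : 'M[R]_3) (Kd : 'M[R]_6).

Definition potential (t : R) (q : 'cV[R]_6) : R :=
  let Rq := rot (fkin q) in let Rd := rot (gd t) in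
  let dp := pos (fkin q) - pos (gd t) in
  \tr (KR *m (1%:M - Rd^T *m Rq))
  + 2^-1 * (dp^T *m Rd *m Kp *m Rd^T *m dp) 0 0.

Definition elastic (t : R) (q : 'cV[R]_6) : 'cV[R]_6 :=
  let Rq := rot (fkin q) in let Rd := rot (gd t) in
  let dp := pos (fkin q) - pos (gd t) in
  col_mx (Rq^T *m Rd *m Kp *m Rd^T *m dp)
         (vee3 (KR *m Rd^T *m Rq - Rq^T *m Rd *m KR)).

Definition Ttilde (q : R -> 'cV[R]_6) (t : R) : 'cV[R]_6 :=
  Mtilde (q t) *m dVdstar q t + Ctilde q t *m Vdstar t (q t) + Gtilde (q t)
  - elastic t (q t) - Kd *m eV t (q t) (derive1 q t).

Definition lyapunov (t : R) (q qd : 'cV[R]_6) : R :=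
  2^-1 * ((eV t q qd)^T *m Mtilde q *m eV t q qd) 0 0 + potential t q.

End Manipulator.

(* Main.v *)
From HB Require Import structures.
From mathcomp Require Import all_boot all_order all_algebra.
From mathcomp Require Import all_classical all_reals all_analysis.
From mathcomp Require Import ring.
(* Last, because [Defs.rot] must shadow [seq.rot]. *)
Require Import Defs.

(* Put y = J_b^-1 e_V = q' - J_b^-1 V_d^*, so that e_V^T Mtilde e_V = y^T M y.
   The control law turns the equation of motion into
     M y' + C y = - J_b^T (f_g + K_d e_V),
   and y^T M' y = 2 y^T C y, whence (y^T M y / 2)' = - e_V^T (f_g + K_d e_V).
   The potential contributes P' = f_g^T e_V, because g' = g hat(V^b) on SE(3)
   and Q^T hat(Q w) Q = hat(w) for rotations Q.
   Differentiability of J_b along the motion comes from Rodrigues' formula: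
   the twist matrix X of a revolute joint satisfies X^3 = - X. *)

Set Implicit Arguments.
Unset Strict Implicit.
Unset Printing Implicit Defensive.

Import Order.TTheory GRing.Theory Num.Theory.
Import numFieldNormedType.Exports.

Local Open Scope ring_scope.
Local Open Scope classical_set_scope.

(** * Derivatives of matrix-valued functions *)

Section MatrixCalculus.
Variable R : realType.

Lemma is_derive_mxP (V : normedModType R) m n (F : V -> 'M[R]_(m, n)) x v D :
  is_derive x v F D <-> forall i j, is_derive x v (fun s => F s i j) (D i j).
Proof.
split=> [[dF <-] i j|dF].
  apply: DeriveDef; first by have /derivable_mxP := dF; apply.
  by rewrite (derive_mx dF) mxE.
have dF' : derivable F x v.
  by apply/derivable_mxP => i j; apply: (@ex_derive _ _ _ _ _ _ _ (dF i j)).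
apply: DeriveDef => //; rewrite derive_mx//; apply/matrixP => i j.
by rewrite mxE; apply: (@derive_val _ _ _ _ _ _ _ (dF i j)).
Qed.

Lemma is_derive_bigsum (V W : normedModType R) (I : Type) (r : seq I)
    (f : I -> V -> W) (df : I -> W) x v :
  (forall i, is_derive x v (f i) (df i)) ->
  is_derive x v (fun s => \sum_(i <- r) f i s) (\sum_(i <- r) df i).
Proof.
move=> h; elim: r => [|i r IH].
  rewrite big_nil; under eq_fun do rewrite big_nil.
  exact: is_derive_cst.
rewrite big_cons; under eq_fun do rewrite big_cons.
exact: (is_deriveD (h i) IH).
Qed.

Lemma derivable_bigprod (V : normedModType R) (I : Type) (r : seq I)
    (f : I -> V -> R) x v :
  (forall i, derivable (f i) x v) ->
  derivable (fun s => \prod_(i <- r) f i s) x v.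
Proof.
move=> h; elim: r => [|i r IH].
  under eq_fun do rewrite big_nil.
  exact: derivable_cst.
under eq_fun do rewrite big_cons.
exact: (derivableM (h i) IH).
Qed.

Lemma is_derive_mulmx (V : normedModType R) m n p (F : V -> 'M[R]_(m, n))
    (G : V -> 'M[R]_(n, p)) x v F' G' :
  is_derive x v F F' -> is_derive x v G G' ->
  is_derive x v (fun s => F s *m G s) (F' *m G x + F x *m G').
Proof.
move=> /is_derive_mxP hF /is_derive_mxP hG; apply/is_derive_mxP => i j.
under eq_fun do rewrite mxE.
apply: is_derive_eq.
  by apply: is_derive_bigsum => k; apply: (is_deriveM (hF i k) (hG k j)).
rewrite !mxE -big_split; apply: eq_bigr => k _ /=.
by rewrite addrC; congr (_ + _); rewrite -?[_ *: _]/(_ * _) // mulrC.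
Qed.

(** In finite dimension [L] is a finite sum of coordinates times the constant matrices
    [L (delta_mx i j)], so linearity alone yields the rule. *)
Lemma is_derive_linear_mx (V : normedModType R) m n p q
    (L : 'M[R]_(m, n) -> 'M[R]_(p, q)) (F : V -> 'M[R]_(m, n)) x v F' :
  linear L -> is_derive x v F F' -> is_derive x v (fun s => L (F s)) (L F').
Proof.
move=> linL /is_derive_mxP hF.
pose fL := GRing.isLinear.Build _ _ _ _ _ linL.
pose LL : {linear _ -> _} := HB.pack L fL.
have LE A : L A = \sum_(ij <- enum {: 'I_m * 'I_n})
    A ij.1 ij.2 *: L (delta_mx ij.1 ij.2).
  rewrite big_enum -(pair_bigA _ (fun i j => A i j *: L (delta_mx i j))) /=.
  rewrite [in LHS](matrix_sum_delta A) -[L]/(LL : _ -> _) linear_sum.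
  apply: eq_bigr => i _; rewrite linear_sum; apply: eq_bigr => j _.
  by rewrite linearZ.
rewrite LE; under eq_fun do rewrite LE.
apply: is_derive_bigsum => -[i j] /=; apply/is_derive_mxP => k l.
under eq_fun do rewrite mxE.
apply: (is_derive_eq (is_deriveM (hF i j) (is_derive_cst (L _ k l) _ _))).
by rewrite scaler0 add0r !mxE -[_ *: _]/(_ * _) mulrC.
Qed.

Lemma is_derive_scalemx (V : normedModType R) m n (c : V -> R)
    (F : V -> 'M[R]_(m, n)) x v c' F' :
  is_derive x v c c' -> is_derive x v F F' ->
  is_derive x v (fun s => c s *: F s) (c' *: F x + c x *: F').
Proof.
move=> hc /is_derive_mxP hF; apply/is_derive_mxP => i j.
under eq_fun do rewrite mxE.
apply: (is_derive_eq (is_deriveM hc (hF i j))).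
by rewrite !mxE addrC; congr (_ + _); rewrite -[_ *: _]/(_ * _) mulrC.
Qed.

Lemma is_derive_trmx (V : normedModType R) m n (F : V -> 'M[R]_(m, n)) x v F' :
  is_derive x v F F' -> is_derive x v (fun s => (F s)^T) F'^T.
Proof. by apply: is_derive_linear_mx => a A B; rewrite linearP. Qed.

Lemma is_derive_block_mx (V : normedModType R) m1 m2 n1 n2
    (A : V -> 'M[R]_(m1, n1)) (B : V -> 'M[R]_(m1, n2))
    (C : V -> 'M[R]_(m2, n1)) (D : V -> 'M[R]_(m2, n2)) x v A' B' C' D' :
  is_derive x v A A' -> is_derive x v B B' ->
  is_derive x v C C' -> is_derive x v D D' ->
  is_derive x v (fun s => block_mx (A s) (B s) (C s) (D s))
    (block_mx A' B' C' D').
Proof.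
move=> /is_derive_mxP hA /is_derive_mxP hB /is_derive_mxP hC /is_derive_mxP hD.
apply/is_derive_mxP => i j.
case: (split_ordP i) => i' ->; case: (split_ordP j) => j' ->.
- by rewrite block_mxEul; under eq_fun do rewrite block_mxEul.
- by rewrite block_mxEur; under eq_fun do rewrite block_mxEur.
- by rewrite block_mxEdl; under eq_fun do rewrite block_mxEdl.
- by rewrite block_mxEdr; under eq_fun do rewrite block_mxEdr.
Qed.

(** The rates [c i] are kept apart from the factors so that the result is visibly linear in them;
    for joint motions they are the joint velocities. *)
Lemma is_derive_prodmx (V : normedModType R) n k (F : 'I_k -> V -> 'M[R]_n)
    (c : 'I_k -> R) (F' : 'I_k -> 'M[R]_n) x v :
  (forall i, is_derive x v (F i) (c i *: F' i)) ->
  is_derive x v (fun s => \prod_(i < k) F i s)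
    (\sum_(j < k) c j *: \prod_(i < k) (if i == j then F' i else F i x)).
Proof.
elim: k F c F' => [|k IH] F c F' h.
  rewrite big_ord0; under eq_fun do rewrite big_ord0.
  exact: is_derive_cst.
under eq_fun do rewrite big_ord_recl.
apply: is_derive_eq.
  apply: (is_derive_mulmx (h ord0)).
  exact: (IH (fun i => F (lift ord0 i)) (fun i => c (lift ord0 i))
             (fun i => F' (lift ord0 i)) (fun i => h (lift ord0 i))).
rewrite [RHS]big_ord_recl big_ord_recl eqxx -scalemxAl mulmx_sumr.
congr (_ + _).
apply: eq_bigr => j _; rewrite -scalemxAr; congr (_ *: _).
by rewrite [RHS]big_ord_recl.
Qed.

Lemma derivable_det (V : normedModType R) n (F : V -> 'M[R]_n) x v :
  derivable F x v -> derivable (fun s => \det (F s)) x v.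
Proof.
move=> /derivable_mxP h.
apply: (@ex_derive _ _ _ _ _ _ _ (is_derive_bigsum (W := R) _ _)) => s.
apply: derivableP.
apply: (derivableM (derivable_cst _ _ _)).
exact: derivable_bigprod.
Qed.

(* The derivative exists by Cramer's rule; its value then follows by
   differentiating F^-1 F = 1. *)
Lemma is_derive_invmx (V : normedModType R) n (F : V -> 'M[R]_n) x v F' :
  (\forall s \near x, F s \in unitmx) -> is_derive x v F F' ->
  is_derive x v (fun s => invmx (F s)) (- (invmx (F x) *m F' *m invmx (F x))).
Proof.
move=> U hF; have Ux := nbhs_singleton U.
have dF := @ex_derive _ _ _ _ _ _ _ hF.
have dinv : derivable (fun s => invmx (F s)) x v.
  apply: (@near_eq_derivable _ _ _ (fun s => (\det (F s))^-1 *: \adj (F s))).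
    by near=> s; rewrite /invmx (_ : F s \in unitmx)//; near: s.
  apply/derivable_mxP => i j; under eq_fun do rewrite !mxE.
  apply: derivableM.
    apply: derivableV; last exact: derivable_det.
    by move: Ux; rewrite unitmxE unitfE.
  apply: (derivableM (derivable_cst _ _ _)); apply: derivable_det.
  have L : linear (fun A : 'M[R]_n => row' j (col' i A)).
    by move=> a A B; apply/matrixP => k l; rewrite !mxE.
  exact: (@ex_derive _ _ _ _ _ _ _ (is_derive_linear_mx L hF)).
have hI := derivableP dinv.
have h1 : is_derive x v (fun s => invmx (F s) *m F s) 0.
  apply: (near_eq_is_derive (f := cst 1%:M)).
  by near=> s; rewrite mulVmx//; near: s.
have := @derive_val _ _ _ _ _ _ _ (is_derive_mulmx hI hF).
rewrite (@derive_val _ _ _ _ _ _ _ h1) => /esym /eqP.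
rewrite addr_eq0 => /eqP /(congr1 (fun A => A *m invmx (F x))).
rewrite mulmxK// mulNmx => E.
by apply: DeriveDef.
Unshelve. all: by end_near. Qed.

Lemma is_derive_mxtrace (V : normedModType R) n (F : V -> 'M[R]_n) x v F' :
  is_derive x v F F' -> is_derive x v (fun s => \tr (F s)) (\tr F').
Proof.
by move=> /is_derive_mxP h; rewrite /mxtrace; apply: is_derive_bigsum.
Qed.

(** The chain rule along a curve, used for the inertia matrix; it rests on Fréchet differentiability
    of [F], since directional derivatives alone do not compose. *)
Lemma is_derive_comp_curve (V W : normedModType R) (F : V -> W)
    (c : R -> V) t c' :
  differentiable F (c t) -> is_derive t (1 : R) c c' ->
  is_derive t (1 : R) (fun s => F (c s)) ('D_c' F (c t)).
Proof.
move=> dF [dc c'E].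
have dc' : differentiable c t by apply/derivable1_diffP.
have dFc : differentiable (F \o c) t by apply: differentiable_comp.
apply: DeriveDef; first by apply/derivable1_diffP.
by rewrite !deriveE// diff_comp//= -c'E deriveE.
Qed.

End MatrixCalculus.

(** * Rigid motions *)

Section RigidMotionKinematics.
Variable R : realType.

(** [hat3] and [vee3] read entries at [inord] indices; splitting indices in this form reduces the
    identities below to [ring]. *)
Lemma ord3_ind (P : 'I_3 -> Prop) :
  P (inord 0) -> P (inord 1) -> P (inord 2) -> forall i, P i.
Proof.
move=> P0 P1 P2 i; rewrite -(inord_val i).
by case: i => -[|[|[|//]]] /= _.
Qed.

Lemma sum_ord3 (V : nmodType) (F : 'I_3 -> V) :
  \sum_(i < 3) F i = F (inord 0) + F (inord 1) + F (inord 2).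
Proof.
rewrite !big_ord_recl big_ord0 addr0 addrA.
by congr (F _ + F _ + F _); apply: val_inj; rewrite /= inordK.
Qed.

Lemma det_ord3 (A : 'M[R]_3) (a := fun i j => A (inord i) (inord j)) :
  \det A = a 0%N 0%N * (a 1%N 1%N * a 2%N 2%N - a 1%N 2%N * a 2%N 1%N)
         - a 0%N 1%N * (a 1%N 0%N * a 2%N 2%N - a 1%N 2%N * a 2%N 0%N)
         + a 0%N 2%N * (a 1%N 0%N * a 2%N 1%N - a 1%N 1%N * a 2%N 0%N).
Proof.
have E i j : A i j = a i j by rewrite /a !inord_val.
have d2 (B : 'M[R]_2) : \det B =
    B ord0 ord0 * B (lift ord0 ord0) (lift ord0 ord0)
    - B ord0 (lift ord0 ord0) * B (lift ord0 ord0) ord0.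
  rewrite (expand_det_row _ ord0) !big_ord_recl big_ord0 /cofactor /=.
  rewrite !det_mx11 !mxE.
  rewrite (_ : lift (lift ord0 ord0) 0 = ord0); last exact: val_inj.
  rewrite !exprD !(expr0, expr1, exprS) /=; ring.
rewrite (expand_det_row _ ord0) !big_ord_recl big_ord0 /cofactor /= !d2 !mxE !E.
have bE : (bump 0 0 = 1%N) * (bump 0 1 = 2%N) * (bump 1 0 = 0%N) *
  (bump 1 1 = 2%N) * (bump 2 0 = 0%N) * (bump 2 1 = 1%N) by [].
rewrite !bE !exprD !(expr0, expr1, exprS).
ring.
Qed.

(** The form x^T hat(w) y is the determinant of the columns x, w, y, and applying [A] to all three
    columns multiplies it by [\det A]. *)
Lemma hat3_conj (A : 'M[R]_3) (w : 'cV[R]_3) :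
  A^T *m hat3 (A *m w) *m A = \det A *: hat3 w.
Proof.
apply/matrixP => i j; rewrite det_ord3.
elim/ord3_ind: i; elim/ord3_ind: j;
  rewrite !(mxE, sum_ord3) !inordK //=.
all: ring.
Qed.

Lemma hat3_rot (Q : 'M[R]_3) (w : 'cV[R]_3) : \det Q = 1 ->
  Q^T *m hat3 (Q *m w) *m Q = hat3 w.
Proof. by move=> dQ; rewrite hat3_conj dQ scale1r. Qed.

(** The trace against a skew matrix sees only the skew part of [A]. This is how [vee3] enters the
    gradient of the rotational potential. *)
Lemma tr_mul_hat3 (A : 'M[R]_3) (w : 'cV[R]_3) :
  \tr (A *m hat3 w) = - ((vee3 (A - A^T))^T *m w) 0 0.
Proof.
rewrite /mxtrace !mxE !sum_ord3 !mxE !sum_ord3 !mxE !inordK //=; ring.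
Qed.

(** For u orthogonal to w, the double cross product w x (w x u) is -|w|^2 u; here u = w x v. *)
Lemma hat3_cube (w : 'cV[R]_3) :
  hat3 w *m hat3 w *m hat3 w = - (w^T *m w) 0 0 *: hat3 w.
Proof.
apply/matrixP => i j.
elim/ord3_ind: i; elim/ord3_ind: j;
  rewrite !mxE !sum_ord3 !mxE !sum_ord3 !mxE !inordK //=; ring.
Qed.

Lemma hat3_linear : linear (@hat3 R).
Proof.
move=> a u v; apply/matrixP => i j.
elim/ord3_ind: i; elim/ord3_ind: j; rewrite !mxE !inordK //=; ring.
Qed.

Lemma hat3N (w : 'cV[R]_3) : hat3 (- w) = - hat3 w.
Proof.
apply/matrixP => i j.
elim/ord3_ind: i; elim/ord3_ind: j; rewrite !mxE !inordK //=; ring.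
Qed.

Lemma vee3_linear : linear (@vee3 R).
Proof.
move=> a u v; apply/matrixP => i j.
elim/ord3_ind: i; rewrite !mxE !inordK //=; ring.
Qed.

Lemma hat3_tr (w : 'cV[R]_3) : (hat3 w)^T = - hat3 w.
Proof.
apply/matrixP => i j.
elim/ord3_ind: i; elim/ord3_ind: j; rewrite !mxE !inordK //=; ring.
Qed.

Lemma hat3_mulNC (u v : 'cV[R]_3) : hat3 u *m v = - (hat3 v *m u).
Proof.
apply/matrixP => i j; rewrite (ord1 j).
elim/ord3_ind: i; rewrite !mxE !sum_ord3 !mxE !inordK //=; ring.
Qed.

Lemma rot_linear : linear (@rot R).
Proof. by move=> a A B; apply/matrixP => i j; rewrite !mxE. Qed.

Lemma pos_linear : linear (@pos R).
Proof. by move=> a A B; apply/matrixP => i j; rewrite !mxE. Qed.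

Lemma vee6_linear : linear (@vee6 R).
Proof.
have E X : vee6 X = col_mx (pos X) (vee3 (rot X)) by [].
move=> a A B; rewrite !E rot_linear pos_linear.
by rewrite vee3_linear scale_col_mx add_col_mx.
Qed.

Lemma SE3_block (Q : 'M[R]_3) (p : 'cV[R]_3) : Q^T *m Q = 1%:M ->
  invmx (block_mx Q p 0 1%:M) = block_mx Q^T (- (Q^T *m p)) 0 1%:M.
Proof.
move=> QQ; have QQ' : Q *m Q^T = 1%:M by apply: mulmx1C.
have E : block_mx Q^T (- (Q^T *m p)) 0 1%:M *m block_mx Q p 0 1%:M = 1%:M
    :> 'M[R]_(3 + 1).
  rewrite mulmx_block !mulmx0 !mul0mx !mulmx1 !add0r !addr0 QQ subrr.
  by rewrite -scalar_mx_block.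
have U : block_mx Q p 0 1%:M \in unitmx.
  by have [] := mulmx1_unit E.
by rewrite -[RHS]mulmx1 -(mulmxV U) mulmxA E mul1mx.
Qed.

Lemma SE3_inv (g : 'M[R]_(3 + 1)) : SE3 g ->
  invmx g = block_mx (rot g)^T (- ((rot g)^T *m pos g)) 0 1%:M.
Proof. by case=> QQ [_ E]; rewrite {1}E SE3_block. Qed.

Lemma SE3_unit (g : 'M[R]_(3 + 1)) : SE3 g -> g \in unitmx.
Proof.
case=> QQ [dQ E]; rewrite unitmxE E det_ublock dQ det1 mulr1.
exact: unitr1.
Qed.

Lemma rot_block (A : 'M[R]_3) b c d : rot (block_mx A b c d) = A.
Proof. exact: block_mxKul. Qed.

Lemma pos_block (A : 'M[R]_3) b c d : pos (block_mx A b c d) = b.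
Proof. exact: block_mxKur. Qed.

(** * Velocities of curves in SE(3) *)

Section Curve.
Variables (g : R -> 'M[R]_(3 + 1)) (t : R).
Hypothesis gSE : \forall s \near t, SE3 (g s).
Hypothesis dg : derivable g t 1.

Lemma is_derive_rot :
  is_derive t (1 : R) (fun s => rot (g s)) (rot (derive1 g t)).
Proof.
by apply: (is_derive_linear_mx rot_linear); rewrite derive1E; apply: derivableP.
Qed.

Lemma is_derive_pos :
  is_derive t (1 : R) (fun s => pos (g s)) (pos (derive1 g t)).
Proof.
by apply: (is_derive_linear_mx pos_linear); rewrite derive1E; apply: derivableP.
Qed.

(** The bottom row of [g] is constant near [t], so it differentiates to zero. *)
Lemma derive1_SE3 :
  derive1 g t = block_mx (rot (derive1 g t)) (pos (derive1 g t)) 0 0.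
Proof.
have h : is_derive t (1 : R) (fun s => block_mx (rot (g s)) (pos (g s)) 0 1%:M)
    (block_mx (rot (derive1 g t)) (pos (derive1 g t)) 0 0).
  exact: (is_derive_block_mx is_derive_rot is_derive_pos
    (is_derive_cst 0 _ _) (is_derive_cst 1%:M _ _)).
rewrite {1}derive1E -(@derive_val _ _ _ _ _ _ _ h); apply: near_eq_derive.
by near=> s; have [_ [_ E]] : SE3 (g s) by near: s.
Unshelve. all: by end_near. Qed.

Lemma body_velocityE : body_velocity g t =
  col_mx ((rot (g t))^T *m pos (derive1 g t))
    (vee3 ((rot (g t))^T *m rot (derive1 g t))).
Proof.
rewrite /body_velocity derive1_SE3 (SE3_inv (nbhs_singleton gSE)) /vee6.
rewrite mulmx_block !mulmx0 !addr0 -/(pos _) -/(rot _) pos_block rot_block.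
by rewrite rot_block pos_block.
Qed.

Lemma rot_derive1 : rot (derive1 g t) =
  rot (g t) *m hat3 (dsubmx (body_velocity g t)).
Proof.
have [QQ _] := nbhs_singleton gSE.
rewrite body_velocityE col_mxKd vee3K.
  by rewrite mulmxA (mulmx1C QQ) mul1mx.
(* The side condition of [vee3K], skewness of Q^T Q', comes from differentiating Q^T Q = 1. *)
have h := is_derive_mulmx (is_derive_trmx is_derive_rot) is_derive_rot.
have h1 : is_derive t (1 : R) (fun s => (rot (g s))^T *m rot (g s)) 0.
  apply: (near_eq_is_derive (f := cst 1%:M)).
  by near=> s; have [-> _] : SE3 (g s) by near: s.
have := @derive_val _ _ _ _ _ _ _ h.
rewrite (@derive_val _ _ _ _ _ _ _ h1) => /esym/eqP; rewrite addr_eq0 => /eqP.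
by rewrite trmx_mul trmxK.
Unshelve. all: by end_near. Qed.

Lemma pos_derive1 : pos (derive1 g t) =
  rot (g t) *m usubmx (body_velocity g t).
Proof.
have [QQ _] := nbhs_singleton gSE.
by rewrite body_velocityE col_mxKu mulmxA (mulmx1C QQ) mul1mx.
Qed.

End Curve.

End RigidMotionKinematics.

(** * Exponentials of revolute twists *)

Section Exponential.
Variable R : realType.

Section Cube.
Variables (n : nat) (X : 'M[R]_n).
Hypothesis X3 : X *m X *m X = - X.

Let exprSm (A : 'M[R]_n) k : A ^+ k.+1 = A *m A ^+ k.
Proof. exact: exprS. Qed.

Lemma expr_cube_odd k : X ^+ k.*2.+1 = (-1) ^+ k *: X.
Proof.
elim: k => [|k IH]; first by rewrite expr0 scale1r expr1.
rewrite doubleS exprSm exprSm mulmxA IH -scalemxAr exprS mulN1r.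
rewrite scaleNr -scalerN.
by congr (_ *: _); rewrite -X3.
Qed.

(** The pattern starts at exponent two: [X ^+ 0] is the identity and is treated apart. *)
Lemma expr_cube_even k : X ^+ k.*2.+2 = (-1) ^+ k *: (X *m X).
Proof. by rewrite exprSm expr_cube_odd -scalemxAr. Qed.

Definition rodrigues (a : R) : 'M[R]_n :=
  1%:M + sin a *: X + (1 - cos a) *: (X *m X).

Lemma expmx_cube (a : R) : expmx (a *: X) = rodrigues a.
Proof.
(* Odd powers feed the sine series, even ones minus the cosine series. At [k = 0] the cosine
   coefficient contributes a spurious [- (X *m X)], which the indicator term compensates. *)
have term k : (k`!%:R)^-1 *: (a *: X) ^+ k = (k == 0)%:R *: (1%:M + X *m X)
    + (sin_coeff a k *: X - cos_coeff a k *: (X *m X)).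
  have aX : (a *: X) ^+ k = a ^+ k *: X ^+ k.
    elim: k => [|k IH]; first by rewrite !expr0 scale1r.
    by rewrite !exprSm IH -scalemxAl -scalemxAr scalerA -exprS.
  rewrite aX scalerA /sin_coeff /cos_coeff /=.
  case: k {aX} => [|k].
    rewrite !expr0 /= fact0 !(mul0r, mul1r, invr1, scale1r, scale0r, add0r).
    by rewrite addrK.
  rewrite scale0r add0r.
  have [j [->|->]] : exists j, k = j.*2 \/ k = j.*2.+1.
    exists k./2; rewrite -{1 3}(odd_double_half k).
    by case: (odd k); [right|left].
  - rewrite expr_cube_odd /= odd_double /= !mul0r scale0r subr0 doubleK mul1r.
    rewrite scalerA; congr (_ *: _); ring.
rewrite expr_cube_even -doubleS /= odd_double /= !mul0r scale0r add0r doubleK.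
  rewrite mul1r scalerA -scaleNr; congr (_ *: _).
  rewrite -exprnP exprS; ring.
apply: cvg_lim => //.
(* The empty partial sum is zero, hence the indicator [0 < m], which is eventually one. *)
have E : (series (fun k : nat => (k`!%:R)^-1 *: (a *: X) ^+ k)) =
  (fun m => (0 < m)%N%:R *: (1%:M + X *m X)
  + (series (sin_coeff a) m *: X - series (cos_coeff a) m *: (X *m X))).
  apply/funext => m; rewrite /series /=; elim: m => [|m IH].
    by rewrite !big_geq // !scale0r subrr addr0.
  rewrite !big_nat_recr //= IH term !scalerDl opprD.
  rewrite (_ : (0 < m.+1)%N%:R = (0 < m)%N%:R + (m == 0)%:R :> R); last first.
    by case: m {IH} => [|m]; rewrite /= ?add0r ?addr0.
  rewrite [in RHS]scalerDl addrACA; congr (_ + _); exact: addrACA.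
rewrite E.
have -> : rodrigues a = 1 *: (1%:M + X *m X) + (sin a *: X - cos a *: (X *m X)).
  rewrite /rodrigues scale1r scalerBl scale1r -!addrA; congr (_ + _).
  by rewrite addrCA.
apply: cvgD.
  apply: cvg_near_cst; exists 1 => // m /= m0.
  by rewrite m0.
apply: cvgB.
  apply: cvgZr_tmp.
  rewrite unlock; exact: is_cvg_series_sin_coeff.
apply: cvgZr_tmp; rewrite unlock; exact: is_cvg_series_cos_coeff.
Qed.

End Cube.

Definition drodrigues n (X : 'M[R]_n) (a : R) : 'M[R]_n :=
  cos a *: X + sin a *: (X *m X).

Lemma is_derive_rodrigues n (X : 'M[R]_n) (c : R -> R) t c' :
  is_derive t (1 : R) c c' ->
  is_derive t (1 : R) (fun s => rodrigues X (c s)) (c' *: drodrigues X (c t)).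
Proof.
move=> hc.
have hs := is_derive1_comp (is_derive_sin (c t)) hc.
have hk := is_derive1_comp (is_derive_cos (c t)) hc.
have h1 := is_deriveB (is_derive_cst (1 : R) t 1) hk.
have hX := is_derive_cst X t (1 : R).
have hXX := is_derive_cst (X *m X) t (1 : R).
apply: (is_derive_eq (is_deriveD (is_deriveD
  (is_derive_cst (1%:M : 'M[R]_n) t (1 : R))
  (is_derive_scalemx hs hX)) (is_derive_scalemx h1 hXX))).
rewrite /drodrigues /cst /= !scaler0 !addr0 !add0r scalerDr !scalerA.
by congr (_ *: _ + _ *: _); rewrite ?mulNr ?opprK mulrC.
Qed.

(** The Jacobian is built from first derivatives of the joint factors, so differentiating it along a
    motion takes this second one. *)
Lemma is_derive_drodrigues n (X : 'M[R]_n) (c : R -> R) t c' :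
  is_derive t (1 : R) c c' ->
  derivable (fun s => drodrigues X (c s)) t (1 : R).
Proof.
move=> hc.
have hs := is_derive1_comp (is_derive_sin (c t)) hc.
have hk := is_derive1_comp (is_derive_cos (c t)) hc.
have hX := is_derive_cst X t (1 : R).
have hXX := is_derive_cst (X *m X) t (1 : R).
exact: (@ex_derive _ _ _ _ _ _ _
  (is_deriveD (is_derive_scalemx hk hX) (is_derive_scalemx hs hXX))).
Qed.

(** The linear part is hat(w) applied to -c, so cubing the twist matrix turns both nonzero blocks
    into hat(w)^3 times a factor, and |w| = 1 gives hat(w)^3 = -hat(w). *)
Lemma revolute_cube (xi : 'cV[R]_(3 + 3)) : revolute xi ->
  hat6 xi *m hat6 xi *m hat6 xi = - hat6 xi.
Proof.
case=> w [c [ww ->]].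
have ww1 : (w^T *m w) 0 0 = 1 by rewrite ww mxE.
rewrite /hat6 col_mxKd col_mxKu -hat3_cross -mulmxN.
rewrite !mulmx_block !mul0mx !mulmx0 !addr0 !mulmxA hat3_cube ww1 scaleN1r.
by rewrite !mul0mx opp_block_mx !oppr0 mulNmx.
Qed.

End Exponential.

(** * Forward kinematics *)

Section ForwardKinematics.
Variables (R : realType) (xi : 'I_6 -> 'cV[R]_(3 + 3)) (g0 : 'M[R]_(3 + 1)).
Hypothesis hxi : forall i, revolute (xi i).

(** The partial derivative of [fkin] in the angle of joint [j]. *)
Definition dfkin (j : 'I_6) (q : 'cV[R]_6) : 'M[R]_(3 + 1) :=
  (\prod_(i < 6) if i == j then drodrigues (hat6 (xi i)) (q i 0)
                 else expmx (q i 0 *: hat6 (xi i))) *m g0.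

Lemma expmx_revolute i a : expmx (a *: hat6 (xi i)) = rodrigues (hat6 (xi i)) a.
Proof. by rewrite expmx_cube //; apply: revolute_cube. Qed.

Lemma is_derive_joint (c : R -> 'cV[R]_6) t c' i : is_derive t (1 : R) c c' ->
  is_derive t (1 : R) (fun s => expmx (c s i 0 *: hat6 (xi i)))
    (c' i 0 *: drodrigues (hat6 (xi i)) (c t i 0)).
Proof.
move=> /is_derive_mxP/(_ i 0) hc.
under eq_fun do rewrite expmx_revolute.
exact: is_derive_rodrigues.
Qed.

Lemma is_derive_fkin (c : R -> 'cV[R]_6) t c' : is_derive t (1 : R) c c' ->
  is_derive t (1 : R) (fun s => fkin xi g0 (c s))
    (\sum_(j < 6) c' j 0 *: dfkin j (c t)).
Proof.
move=> hc; rewrite /fkin.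
have h := is_derive_prodmx (fun i => is_derive_joint i hc).
apply: (is_derive_eq (is_derive_mulmx h (is_derive_cst g0 t (1 : R)))).
rewrite mulmx0 addr0 mulmx_suml; apply: eq_bigr => j _.
by rewrite -scalemxAl.
Qed.

Lemma derivable_dfkin (c : R -> 'cV[R]_6) t j : derivable c t (1 : R) ->
  derivable (fun s => dfkin j (c s)) t (1 : R).
Proof.
move=> /derivableP hc; rewrite /dfkin.
pose F i s := if i == j then drodrigues (hat6 (xi i)) (c s i 0)
                 else expmx (c s i 0 *: hat6 (xi i)).
(* The unit factor gives the scaled form that [is_derive_prodmx] expects. *)
have hF i : is_derive t (1 : R) (F i) (1 *: 'D_1 (F i) t).
  rewrite scale1r; apply: derivableP; rewrite /F; case: eqP => _.
    by have /is_derive_mxP/(_ i 0) := hc; apply: is_derive_drodrigues.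
  exact: (@ex_derive _ _ _ _ _ _ _ (is_derive_joint i hc)).
exact: (@ex_derive _ _ _ _ _ _ _
  (is_derive_mulmx (is_derive_prodmx hF) (is_derive_cst g0 t (1 : R)))).
Qed.

Lemma derive_fkin q v : 'D_v (fkin xi g0) q = \sum_(j < 6) v j 0 *: dfkin j q.
Proof.
(* The directional derivative along [v] is the derivative at zero along this line, a curve to which
   [is_derive_fkin] applies. *)
have hc : is_derive (0 : R) (1 : R) (fun h : R => h *: v + q) v.
  apply: (is_derive_eq (is_deriveD (is_derive_scalemx (is_derive_id (0 : R)
    (1 : R)) (is_derive_cst v _ _)) (is_derive_cst q (0 : R) (1 : R)))).
  by rewrite scale1r scale0r !addr0.
have := @derive_val _ _ _ _ _ _ _ (is_derive_fkin hc).
rewrite scale0r add0r => <-; rewrite /derive.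
set f1 := fun h => h^-1 *: _; set f2 := fun h => h^-1 *: _.
suff -> : f1 = f2 by [].
by rewrite funeqE /f1 /f2 => h /=; rewrite addr0 scale0r add0r [_%:A]mulr1.
Qed.

Lemma Vb_delta q j : Vb xi g0 q (delta_mx j 0) =
  vee6 (invmx (fkin xi g0 q) *m dfkin j q).
Proof.
rewrite /Vb derive_fkin (bigD1 j) //= big1 ?addr0 => [|i ij].
  by rewrite mxE !eqxx scale1r.
by rewrite mxE (negbTE ij) scale0r.
Qed.

(** [Jb] is given by its columns; [derive_fkin] is linear in the velocity and so is [vee6], hence
    the columns determine [Vb]. *)
Lemma Vb_Jb q v : Vb xi g0 q v = Jb xi g0 q *m v.
Proof.
pose fL := GRing.isLinear.Build _ _ _ _ _ (@vee6_linear R).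
pose L : {linear _ -> _} := HB.pack (@vee6 R) fL.
rewrite /Vb derive_fkin mulmx_sumr -[vee6 _]/(L _) linear_sum.
apply/colP => i; rewrite summxE mxE; apply: eq_bigr => j _.
rewrite -scalemxAr linearZ [in RHS]mxE Vb_delta mxE.
by rewrite mulrC.
Qed.

Lemma Vb_body_velocity (q : R -> 'cV[R]_6) t : derivable q t (1 : R) ->
  Vb xi g0 (q t) (derive1 q t) = body_velocity (fun s => fkin xi g0 (q s)) t.
Proof.
move=> /derivableP hq; rewrite /Vb /body_velocity derive_fkin derive1E derive1E.
by rewrite (@derive_val _ _ _ _ _ _ _ (is_derive_fkin hq)).
Qed.

Lemma derivable_Jb (q : R -> 'cV[R]_6) t : derivable q t (1 : R) ->
  (\forall s \near t, fkin xi g0 (q s) \in unitmx) ->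
  derivable (fun s => Jb xi g0 (q s)) t (1 : R).
Proof.
move=> dq U; apply/derivable_mxP => i j.
have hinv := is_derive_invmx U (is_derive_fkin (derivableP dq)).
have h := is_derive_linear_mx (@vee6_linear R)
  (is_derive_mulmx hinv (derivableP (@derivable_dfkin q t j dq))).
under eq_fun do rewrite mxE Vb_delta.
by have /is_derive_mxP/(_ i 0)[] := h.
Qed.

End ForwardKinematics.

(** * Lyapunov function *)

Section Coriolis.
Variable R : realType.

Lemma quadE n (A : 'M[R]_n) (y : 'cV[R]_n) :
  (y^T *m A *m y) 0 0 = \sum_r \sum_s y r 0 * y s 0 * A r s.
Proof.
rewrite exchange_big mxE; apply: eq_bigr => s _.
rewrite !mxE mulr_suml; apply: eq_bigr => r _.
by rewrite mxE mulrAC.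
Qed.

(* The last two terms of the Coriolis coefficients are exchanged by r <-> s, so
   they cancel in the quadratic form. *)
Lemma coriolis_quad (M : 'cV[R]_6 -> 'M[R]_6) (q qd y : 'cV[R]_6) :
  differentiable M q ->
  (y^T *m 'D_qd M q *m y) 0 0 = 2 * (y^T *m coriolis M q qd *m y) 0 0.
Proof.
move=> dM.
pose d (r s k : 'I_6) := 'D_(delta_mx k 0 : 'cV[R]_6) (fun x => M x r s) q.
(* Differentiability expands the derivative along [qd] into the partial derivatives of the Coriolis
   formula. *)
have DE r s : ('D_qd M q) r s = \sum_k d r s k * qd k 0.
  rewrite deriveE// {1}[qd]matrix_sum_delta linear_sum summxE.
  apply: eq_bigr => k _; rewrite big_ord1 linearZ mxE mulrC; congr (_ * _).
  rewrite -deriveE// derive_mx ?mxE//; exact: diff_derivable.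
pose B r s := \sum_k d k r s * qd k 0.
have CE r s : 2 * coriolis M q qd r s = ('D_qd M q) r s + (B r s - B s r).
  rewrite mxE mulrA divff ?pnatr_eq0// mul1r DE -sumrB -big_split /=.
  apply: eq_bigr => k _; rewrite -/(d _ _ _) -/(d _ _ _) -/(d _ _ _).
  by rewrite mulrBl mulrDl addrA.
rewrite !quadE mulr_sumr; under [RHS]eq_bigr do rewrite mulr_sumr.
under [RHS]eq_bigr => r _.
  under eq_bigr => s _.
    rewrite mulrCA CE mulrDr mulrBr; over.
  rewrite big_split sumrB /=; over.
rewrite big_split sumrB /= -[LHS]addr0; congr (_ + _).
apply/esym/eqP; rewrite subr_eq0 exchange_big; apply/eqP.
by apply: eq_bigr => r _; apply: eq_bigr => s _; rewrite [y r 0 * _]mulrC.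
Qed.

End Coriolis.

(** * Derivative of the potential along two curves in SE(3) *)

Section Potential.
Variables (R : realType) (Kp KR : 'M[R]_3).
Variables (g h : R -> 'M[R]_(3 + 1)) (t : R).
Hypotheses (Kp_sym : Kp^T = Kp) (KR_sym : KR^T = KR).
Hypotheses (gSE : \forall s \near t, SE3 (g s)) (dg : derivable g t 1).
Hypotheses (hSE : \forall s \near t, SE3 (h s)) (dh : derivable h t 1).

Let Q := rot (g t).
Let P := rot (h t).
Let dp := pos (g t) - pos (h t).
Let V := body_velocity g t.
Let W := body_velocity h t.
(** [E] is the relative rotation R_ed, and [d] the position error in the desired frame. *)
Let E := Q^T *m P.
Let d := P^T *m dp.

(** The relative position p_ed is -Q^T dp = -E d, whence the plus sign before [hat3]. Writing it
    through [E] prepares the use of [hat3_rot]. *)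
Lemma Ad_mul_body_velocity :
  V - Ad (invmx (g t) *m h t) *m W =
  col_mx (usubmx V - E *m usubmx W + hat3 (E *m d) *m E *m dsubmx W)
         (dsubmx V - E *m dsubmx W).
Proof.
have [QQ _] := nbhs_singleton gSE; have [PP [_ hE]] := nbhs_singleton hSE.
have EdE : E *m d = Q^T *m dp.
  by rewrite /E /d -mulmxA (mulmxA P) (mulmx1C PP) mul1mx.
rewrite EdE (SE3_inv (nbhs_singleton gSE)) hE mulmx_block /Ad.
rewrite !mulmx0 !mul0mx !mulmx1 !addr0 !rot_block !pos_block.
rewrite (_ : Q^T *m _ - _ = - (Q^T *m dp)); last by rewrite mulmxBr opprB.
rewrite hat3N -[in LHS](vsubmxK V) -[in LHS](vsubmxK W) mul_block_col.
by rewrite opp_col_mx add_col_mx mul0mx add0r !mulNmx opprD opprK addrA.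
Qed.

(** In the desired frame the potential is tr(KR (1 - E^T)) + d^T Kp d / 2. The first term pairs with
    the angular part of the velocity error, the second with the linear part. *)
Lemma is_derive_potential :
  is_derive t (1 : R)
    (fun s => \tr (KR *m (1%:M - (rot (h s))^T *m rot (g s)))
      + 2^-1 * ((pos (g s) - pos (h s))^T *m rot (h s) *m Kp *m (rot (h s))^T
                *m (pos (g s) - pos (h s))) 0 0)
    (((col_mx (Q^T *m P *m Kp *m P^T *m dp)
         (vee3 (KR *m P^T *m Q - Q^T *m P *m KR)))^T
     *m (V - Ad (invmx (g t) *m h t) *m W)) 0 0).
Proof.
have [QQ [dQ _]] := nbhs_singleton gSE; have [PP [dP _]] := nbhs_singleton hSE.
have EE : E^T *m E = 1%:M.
  by rewrite trmx_mul trmxK mulmxA -(mulmxA P^T) (mulmx1C QQ) mulmx1.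
have ET : P^T *m Q = E^T by rewrite trmx_mul trmxK.
have dE : \det E = 1 by rewrite det_mulmx det_tr dQ dP mulr1.
have hg := is_derive_rot dg; have hh := is_derive_rot dh.
rewrite (rot_derive1 gSE dg) in hg; rewrite (rot_derive1 hSE dh) in hh.
have kg := is_derive_pos dg; have kh := is_derive_pos dh.
rewrite (pos_derive1 gSE dg) in kg; rewrite (pos_derive1 hSE dh) in kh.
(* The rate of [d]: the relative linear velocity in the desired frame, corrected for the rotation of
   that frame. *)
pose d' := P^T *m Q *m usubmx V - usubmx W - hat3 (dsubmx W) *m d.
have hd : is_derive t (1 : R)
    (fun s => (rot (h s))^T *m (pos (g s) - pos (h s))) d'.
  apply: (is_derive_eq (is_derive_mulmx (is_derive_trmx hh)
    (is_deriveB kg kh))).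
  rewrite trmx_mul hat3_tr !mulNmx [X in _ + X]mulmxBr.
  rewrite [X in _ + (X - _)]mulmxA [X in _ + (_ - X)]mulmxA PP mul1mx.
  by rewrite addrC /d' -!mulmxA.
have hT : is_derive t (1 : R)
    (fun s => \tr (KR *m (1%:M - (rot (h s))^T *m rot (g s))))
    (- \tr (KR *m E^T *m hat3 (dsubmx V)) + \tr (KR *m hat3 (dsubmx W) *m E^T)).
  apply: (is_derive_eq (is_derive_mxtrace (is_derive_mulmx
    (is_derive_cst KR t (1 : R)) (is_deriveB (is_derive_cst 1%:M t (1 : R))
      (is_derive_mulmx (is_derive_trmx hh) hg))))).
  rewrite mul0mx add0r sub0r trmx_mul hat3_tr !mulNmx opprD opprK mulmxDr.
  rewrite mulmxN raddfD raddfN /= addrC -ET.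
  by rewrite !mulmxA.
have hP := is_derive_mulmx (is_derive_mulmx (is_derive_trmx hd)
  (is_derive_cst Kp t (1 : R))) hd.
have /is_derive_mxP/(_ 0 0) hP0 := hP.
have hS := is_deriveD hT (is_deriveZ 2^-1 hP0).
have -> : (fun s => \tr (KR *m (1%:M - (rot (h s))^T *m rot (g s)))
      + 2^-1 * ((pos (g s) - pos (h s))^T *m rot (h s) *m Kp *m (rot (h s))^T
                *m (pos (g s) - pos (h s))) 0 0) =
   (fun s => \tr (KR *m (1%:M - (rot (h s))^T *m rot (g s)))) +
     2^-1 *: (fun s => (((rot (h s))^T *m (pos (g s) - pos (h s)))^T *m Kp *m
      ((rot (h s))^T *m (pos (g s) - pos (h s)))) 0 0).
  apply/funext => s /=; congr (_ + 2^-1 * _).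
  by rewrite trmx_mul trmxK !mulmxA.
apply: (is_derive_eq hS).
rewrite Ad_mul_body_velocity tr_col_mx mul_row_col [RHS]mxE [LHS]addrC.
congr (_ + _).
(* By [hat3_rot] the last term becomes hat(d) w_d = -hat(w_d) d, so [E^T] carries the linear
   velocity error to [d']. *)
- have Ed' : E^T *m (usubmx V - E *m usubmx W
      + hat3 (E *m d) *m E *m dsubmx W) = d'.
    rewrite mulmxDr mulmxBr (mulmxA E^T E) EE mul1mx.
    rewrite (mulmxA E^T (_ *m E)) (mulmxA E^T _ E) hat3_rot// hat3_mulNC -ET.
    by [].
  have -> : Q^T *m P *m Kp *m P^T *m dp = E *m (Kp *m d) by rewrite !mulmxA.
  rewrite (trmx_mul E) -(mulmxA _ E^T) Ed' (trmx_mul Kp) Kp_sym.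
  (* Symmetry of [Kp] makes the two product-rule terms equal, which absorbs the factor one half. *)
  have dd : d'^T *m Kp *m d = (d^T *m Kp *m d')^T.
    by rewrite (trmx_mul (d^T *m Kp)) (trmx_mul d^T) trmxK Kp_sym mulmxA.
  rewrite mulmx0 addr0 mxE -/d dd [X in X + _]mxE -mulr2n.
  rewrite -[LHS]/(2^-1 * _) mulrnAr -mulrnAl -[2^-1 *+ 2]mulr_natr.
  by rewrite mulVf ?pnatr_eq0// mul1r.
(* Symmetry of [KR] yields the form A - A^T required by [tr_mul_hat3]. *)
- have BE : KR *m P^T *m Q - Q^T *m P *m KR = KR *m E^T - (KR *m E^T)^T.
    by rewrite (trmx_mul KR) trmxK KR_sym -(mulmxA KR) ET.
  have tE w : ((vee3 (KR *m E^T - (KR *m E^T)^T))^T *m w) 0 0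
      = - \tr (KR *m E^T *m hat3 w) by rewrite tr_mul_hat3 opprK.
  have EW : E^T *m hat3 (E *m dsubmx W) = hat3 (dsubmx W) *m E^T.
    by rewrite -(hat3_rot (dsubmx W) dE) -(mulmxA _ E E^T) (mulmx1C EE) mulmx1.
  rewrite BE mulmxBr [RHS]mxE tE [X in _ = _ + X]mxE tE opprK.
  by rewrite -(mulmxA KR _ (hat3 (E *m _))) EW (mulmxA KR).
Qed.

End Potential.

(** * Closed-loop dynamics and dissipation *)

Lemma derivable_Ad (R : realType) (g : R -> 'M[R]_(3 + 1)) t :
  derivable g t (1 : R) -> derivable (fun s => Ad (g s)) t (1 : R).
Proof.
move=> dg; have hr := is_derive_rot dg.
have hh := is_derive_linear_mx (@hat3_linear R) (is_derive_pos dg).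
exact: (@ex_derive _ _ _ _ _ _ _ (is_derive_block_mx hr
  (is_derive_mulmx hh hr) (is_derive_cst 0 t (1 : R)) hr)).
Qed.

(** [J^T] cancels the inverse transposes of the control law, and the [J'] correction to the Coriolis
    matrix supplies exactly the [J'] term in the derivative of J^-1 V. *)
Lemma closed_loop (R : comUnitRingType) n (J J' M C Kd : 'M[R]_n)
    (q1 q2 G V V' f : 'cV[R]_n) :
  J \in unitmx ->
  M *m q2 + C *m q1 + G =
    J^T *m ((invmx J)^T *m M *m invmx J *m V'
    + (invmx J)^T *m (C - M *m invmx J *m J') *m invmx J *m V
    + (invmx J)^T *m G - f - Kd *m (J *m q1 - V)) ->
  M *m (q2 - (invmx J *m V' - invmx J *m J' *m invmx J *m V))
    + C *m (q1 - invmx J *m V) = - (J^T *m (f + Kd *m (J *m q1 - V))).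
Proof.
move=> UJ; have JJ : J^T *m (invmx J)^T = 1%:M.
  by rewrite -trmx_mul mulVmx// trmx1.
rewrite !(mulmxBr, mulmxDr, mulmxBl, mulmxDl) !mulmxA !JJ !mul1mx.
move=> /eqP; rewrite -subr_eq0 => /eqP H; apply/eqP; rewrite -subr_eq0 -H.
by apply/eqP/matrixP => i j; rewrite !mxE; ring.
Qed.

Theorem theorem1 (R : realType)
  (* the manipulator *)
  (xi : 'I_6 -> 'cV[R]_(3 + 3)) (g0 : 'M[R]_(3 + 1))
  (M : 'cV[R]_6 -> 'M[R]_6) (G : 'cV[R]_6 -> 'cV[R]_6)
  (hxi : forall i : 'I_6, revolute (xi i))
  (hg0 : SE3 g0)
  (hM : forall th : 'cV[R]_6, sym_posdef (M th))
  (hMdiff : forall th : 'cV[R]_6, differentiable M th)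
  (hMper : joint_periodic M) (hGper : joint_periodic G)
  (* the gains *)
  (Kp KR : 'M[R]_3) (Kd : 'M[R]_6)
  (hKp : sym_posdef Kp) (hKR : sym_posdef KR) (hKd : sym_posdef Kd)
  (* the open time interval on which everything takes place *)
  (I : set R) (hIo : open I) (hI : is_interval I)
  (* the desired trajectory *)
  (gd : R -> 'M[R]_(3 + 1))
  (hgd : forall t : R, I t -> SE3 (gd t))
  (hgd1 : forall t : R, I t ->
     derivable gd t 1 /\ {for t, continuous (derive1 gd)})
  (hVd : forall t : R, I t -> derivable (body_velocity gd) t 1)
  (* the motion and the torques *)
  (q T Te : R -> 'cV[R]_6)
  (hq : forall t : R, I t -> derivable q t 1 /\ derivable (derive1 q) t 1)
  (hdyn : forall t : R, I t ->
     M (q t) *m derive1 (derive1 q) t + coriolis M (q t) (derive1 q t) *m derive1 q t + G (q t)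
     = T t + Te t)
  (* (A1) *)
  (D : set 'M[R]_(3 + 1)) (hDSE : D `<=` @SE3 R)
  (hDJ : forall th : 'cV[R]_6, D (fkin xi g0 th) -> Jb xi g0 th \in unitmx)
  (hqD : forall t : R, I t -> D (fkin xi g0 (q t)))
  (* (A2) *)
  (hqreach : forall t : R, I t -> reachable xi g0 (pos (fkin xi g0 (q t))))
  (hdreach : forall t : R, I t -> reachable xi g0 (pos (gd t)))
  (* the control law, without external disturbance *)
  (hT : forall t : R, I t ->
     T t = (Jb xi g0 (q t))^T *m Ttilde xi g0 M G gd Kp KR Kd q t)
  (hTe : forall t : R, I t -> Te t = 0) :
  forall t : R, I t ->
    is_derive t (1 : R)
      (fun s : R => lyapunov xi g0 M gd Kp KR s (q s) (derive1 q s))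
      (- ((eV xi g0 gd t (q t) (derive1 q t))^T *m Kd
          *m eV xi g0 gd t (q t) (derive1 q t)) 0 0).
Proof.
move=> t It.
(* Openness of [I] spreads the hypotheses to a neighbourhood of [t], where invertibility and SE(3)
   membership can be differentiated. *)
have nI : \forall s \near t, I s by apply: open_nbhs_nbhs; split.
have [dq ddq] := hq t It; have [dgd _] := hgd1 t It.
have fSE : \forall s \near t, SE3 (fkin xi g0 (q s)).
  by near=> s; apply/hDSE/hqD; near: s.
have gSE : \forall s \near t, SE3 (gd s) by near=> s; apply: hgd; near: s.
have Ufk : \forall s \near t, fkin xi g0 (q s) \in unitmx.
  by near=> s; apply: SE3_unit; near: s.
have UJ : \forall s \near t, Jb xi g0 (q s) \in unitmx.
  by near=> s; apply/hDJ/hqD; near: s.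
have hfk := is_derive_fkin g0 hxi (derivableP dq).
have dfk := @ex_derive _ _ _ _ _ _ _ hfk.
pose Ji s := invmx (Jb xi g0 (q s)).
pose V s := Vdstar xi g0 gd s (q s).
pose e s := eV xi g0 gd s (q s) (derive1 q s).
pose y s := derive1 q s - Ji s *m V s.
have hJi : is_derive t (1 : R) Ji
    (- (Ji t *m derive1 (Jb xi g0 \o q) t *m Ji t)).
  rewrite derive1E; apply: is_derive_invmx => //.
  exact: derivableP (derivable_Jb hxi dq Ufk).
have hV : is_derive t (1 : R) V (dVdstar xi g0 gd q t).
  have hAd : derivable (fun s => Ad (ged xi g0 gd s (q s))) t (1 : R).
    apply: derivable_Ad.
    exact: (@ex_derive _ _ _ _ _ _ _ (is_derive_mulmx
      (is_derive_invmx Ufk hfk) (derivableP dgd))).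
  rewrite /dVdstar !derive1E.
  exact: (is_derive_mulmx (derivableP hAd) (derivableP (hVd t It))).
have hy : is_derive t (1 : R) y (derive1 (derive1 q) t
    - (Ji t *m dVdstar xi g0 gd q t
       - Ji t *m derive1 (Jb xi g0 \o q) t *m Ji t *m V t)).
  have hqq : is_derive t (1 : R) (derive1 q) (derive1 (derive1 q) t).
    by rewrite (derive1E (derive1 q)); apply: derivableP.
  apply: (is_derive_eq (is_deriveB hqq (is_derive_mulmx hJi hV))).
  by rewrite mulNmx [X in _ - X]addrC.
(* The rate of [M] along the motion, as the directional derivative appearing in [coriolis_quad]. *)
have hMq := is_derive_comp_curve (hMdiff (q t)) (derivableP dq).
rewrite -derive1E in hMq.
have hP : is_derive t (1 : R) (fun s => potential xi g0 gd Kp KR s (q s))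
    (((elastic xi g0 gd Kp KR t (q t))^T *m e t) 0 0).
  rewrite /e /eV (Vb_body_velocity g0 hxi dq).
  exact: (is_derive_potential hKp.1 hKR.1 fSE dfk gSE dgd).
have ey s : Jb xi g0 (q s) \in unitmx -> e s = Jb xi g0 (q s) *m y s.
  by move=> UJs; rewrite /e /eV Vb_Jb// mulmxBr mulmxA mulmxV// mul1mx.
have main : M (q t) *m (derive1 (derive1 q) t
    - (Ji t *m dVdstar xi g0 gd q t
       - Ji t *m derive1 (Jb xi g0 \o q) t *m Ji t *m V t))
    + coriolis M (q t) (derive1 q t) *m y t
    = - ((Jb xi g0 (q t))^T *m (elastic xi g0 gd Kp KR t (q t) + Kd *m e t)).
  have := hdyn t It; rewrite hTe// addr0 hT//.
  rewrite /Ttilde /Mtilde /Ctilde /Gtilde /e /eV Vb_Jb//.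
  by move/(closed_loop (nbhs_singleton UJ)).
(* Wherever [Jb] is invertible, e = J y turns the kinetic term into y^T M y; this holds near [t],
   which suffices for the derivative. *)
apply: (@near_eq_is_derive _ _ _
    (fun s => 2^-1 * ((y s)^T *m M (q s) *m y s) 0 0
      + potential xi g0 gd Kp KR s (q s))).
  near=> s; rewrite /lyapunov -/(e s) ey; last by near: s.
  congr (_ * _ + _).
  have UJs : Jb xi g0 (q s) \in unitmx by near: s.
  congr (fun_of_matrix _ 0 0).
  rewrite /Mtilde trmx_mul !mulmxA -[in RHS](mulmxA (y s)^T).
  rewrite -(trmx_mul (invmx (Jb xi g0 (q s)))) mulVmx// trmx1 mulmx1.
  by rewrite mulmxKV.
have hyMy := is_derive_mulmx (is_derive_mulmx (is_derive_trmx hy) hMq) hy.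
have /is_derive_mxP/(_ 0 0) h0 := hyMy.
apply: (is_derive_eq (is_deriveD (is_deriveZ 2^-1 h0) hP)).
set y' := derive1 (derive1 q) t - _ in main *.
set f := elastic xi g0 gd Kp KR t (q t) in main *.
have tr00 (A : 'M[R]_1) : A 0 0 = A^T 0 0 by rewrite mxE.
(* Symmetry of [M] identifies the two terms of the product rule that contain [y']. *)
have a1 : (y'^T *m M (q t) *m y t) 0 0 = ((y t)^T *m M (q t) *m y') 0 0.
  by rewrite tr00 !trmx_mul trmxK (hM (q t)).1 mulmxA.
have a2 := coriolis_quad (derive1 q t) (y t) (hMdiff (q t)).
(* The closed-loop equation is solved for M y' and paired with [y], using y^T J^T = e^T. *)
have a3 : ((y t)^T *m M (q t) *m y') 0 0 = - (f^T *m e t) 0 0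
    - ((e t)^T *m Kd *m e t) 0 0
    - ((y t)^T *m coriolis M (q t) (derive1 q t) *m y t) 0 0.
  have My' : M (q t) *m y' = - ((Jb xi g0 (q t))^T *m (f + Kd *m e t))
      - coriolis M (q t) (derive1 q t) *m y t by rewrite -main addrK.
  rewrite -[in LHS]mulmxA My' mulmxBr mulmxN mulmxA -trmx_mul.
  rewrite -(ey t (nbhs_singleton UJ)) mulmxDr !mulmxA opprD.
  rewrite (tr00 (f^T *m _)) trmx_mul trmxK.
  by rewrite !mxE.
have D00 (A B : 'M[R]_1) : (A + B) 0 0 = A 0 0 + B 0 0 by rewrite mxE.
(* The Coriolis terms cancel, the elastic power cancels the rate of the potential, and only the
   damping term remains. *)
rewrite mulmxDl !D00 a1 a2 a3 -[2^-1 *: _]/(2^-1 * _) -/(e t).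
by field.
Unshelve. all: by end_near. Qed.
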